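(* Let $n \geq 3$ be an integer. Approval ballot hypertriangles $(A_{n-2}, A_{n-3}, \ldots, A_1)$ of size $n-2$ are in bijection with strict-sense ballots for $n$ candidates.
   Context: An approval ballot triangle (ABT) of size $m$ is a triangular array $A(i,j)$, $1 \leq j \leq i \leq m$, with entries in $\{0,1\}$ such that $\sum_{k=j}^{i} A(i,k) \leq \sum_{k=j}^{i+1} A(i+1,k)$ for all $1 \leq j \leq i \leq m-1$; $\mathcal{A}_m$ is the set of ABTs of size $m$. For a triangular array $T$, $T(i,[j:k])$ denotes the sub-row $(T(i,j),T(i,j+1),\dots,T(i,k))$. For binary sequences $S=(s_1,\dots,s_p)$ and $T=(t_1,\dots,t_q)$, write $S \prec T$ (also written $S \preceq T$; the two symbols denote the same relation) when $p \leq q$ and $\sum_{k=\ell}^{p} s_k \leq \sum_{k=\ell}^{q} t_k$ for all $1 \leq \ell \leq p$. An approval ballot hypertriangle (ABH) of size $m$ is a sequence $(A_m, A_{m-1},\dots,A_1)$ with $A_s \in \mathcal{A}_s$ such that, whenever $A_s(t,u)=1$ with $2 \leq u \leq t \leq s$, setting $s' = s - \sum_{j=u}^{t} A_s(t,j)$ and $t' = u-1$, we have $A_{s'}(t'-1,[1:t'-1]) \prec A_s(t,[1:t'])$ whenever $1 < t' \leq s'$, and $A_s(t,[1:t']) \preceq A_{s'}(t',[1:t'])$ whenever $1 \leq t' \leq s'$. A strict-sense ballot for $n$ candidates: candidate $k$ ($1\le k\le n$) receives exactly $n+1-k$ votes, and a strict-sense ballot is an ordering (a sequence) of these $\binom{n+1}{2}$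 votes in which candidate $k$ always leads candidate $k+1$ for $1 \leq k \leq n-1$; precisely, for every $k$ and every $i \ge 1$, the $i$-th vote for candidate $k+1$ occurs after the $(i+1)$-th vote for candidate $k$ (equivalently, such orderings correspond to shifted standard Young tableaux of staircase shape $(n,n-1,\dots,1)$, row $k$ listing the positions of the votes for candidate $k$). *)

(* Defs.v *)
From mathcomp Require Import all_boot.

Set Implicit Arguments.
Unset Strict Implicit.
Unset Printing Implicit Defensive.

(* A triangular array T(i,j), 1 <= j <= i <= m, is the list of its rows,
   row i having length i; all indices below are 1-based, as on paper.
   [entry] and [subrow] return the junk value [false] out of range, but are
   only used in range. *)
Definition triangle := seq (seq bool).

Definition triangle_shape (m : nat) (T : triangle) : bool :=
  shape T == iota 1 m.

Definition entry (T : triangle) (i j : nat) : bool :=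
  nth false (nth [::] T i.-1) j.-1.

Definition subrow (T : triangle) (i j k : nat) : seq bool :=
  [seq entry T i l | l <- index_iota j k.+1].

Definition prec (S T : seq bool) : bool :=
  (size S <= size T) &&
  [forall l : 'I_(size S).+1, (1 <= l) ==>
     (\sum_(l <= k < (size S).+1) nth false S k.-1
        <= \sum_(l <= k < (size T).+1) nth false T k.-1)].

Definition is_ABT (m : nat) (A : triangle) : bool :=
  triangle_shape m A &&
  [forall i : 'I_m.+1, forall j : 'I_m.+1,
     (1 <= j <= i) && (i <= m - 1) ==>
     (\sum_(j <= k < i.+1) entry A i k
        <= \sum_(j <= k < i.+2) entry A i.+1 k)].

(* In a list H = (A_m, A_(m-1), ..., A_1), the component A_s. *)
Definition component (H : seq triangle) (s : nat) : triangle :=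
  nth [::] H (size H - s).

Definition ABH_condition (H : seq triangle) (s t u : nat) : bool :=
  let s' := s - \sum_(u <= j < t.+1) entry (component H s) t j in
  let t' := u - 1 in
  ((1 < t' <= s') ==>
     prec (subrow (component H s') (t' - 1) 1 (t' - 1))
          (subrow (component H s) t 1 t')) &&
  ((1 <= t' <= s') ==>
     prec (subrow (component H s) t 1 t')
          (subrow (component H s') t' 1 t')).

Definition is_ABH (m : nat) (H : seq triangle) : bool :=
  [&& size H == m,
      [forall s : 'I_m.+1, (1 <= s) ==> is_ABT s (component H s)] &
      [forall s : 'I_m.+1, forall t : 'I_m.+1, forall u : 'I_m.+1,
         [&& 2 <= u, u <= t, t <= s & entry (component H s) t u] ==>
         ABH_condition H s t u]].

Definition ABH (m : nat) : Type := {H : seq triangle | is_ABH m H}.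

(* Increasing list of the (1-based) positions of the votes for k in w; this is
   row k of the corresponding shifted tableau. *)
Definition vote_positions (w : seq nat) (k : nat) : seq nat :=
  [seq p <- iota 1 (size w) | nth 0 w p.-1 == k].

(* Position of the i-th vote for candidate k, for 1 <= i. *)
Definition vote_position (w : seq nat) (k i : nat) : nat :=
  nth 0 (vote_positions w k) i.-1.

(* Candidates are 1, ..., n.  Since candidate k.+1 has n - k votes and candidate
   k has n - k + 1 of them, i ranges over 1 <= i <= n - k below. *)
Definition is_strict_ballot (n : nat) (w : seq nat) : bool :=
  [&& all (fun k => 1 <= k <= n) w,
      [forall k : 'I_n.+1, (1 <= k) ==> (count_mem (k : nat) w == n + 1 - k)] &
      [forall k : 'I_n.+1, forall i : 'I_n.+1,
         (1 <= k <= n - 1) && (1 <= i <= n - k) ==>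
         (vote_position w k i.+1 < vote_position w k.+1 i)]].

Definition strict_ballot (n : nat) : Type :=
  {w : seq nat | is_strict_ballot n w}.

(* Main.v *)
Require Import Defs.
From mathcomp Require Import all_boot zify.

(** Just before the (t+2)-th vote for candidate k, the vote counts of the
    candidates below k are strictly decreasing as long as they are positive, and
    at most t: they form a subset of {1, ..., t}, and the indicator of this subset
    is row t of A_(n-1-k).  Componentwise growth of the counts is the ABT
    inequality.  The remaining condition is proved by erasing candidate 1: a
    ballot for n+1 candidates amounts to a ballot w for n candidates together
    with the weakly increasing sequence of the places of w at which the votes for
    the new top candidate are inserted.  Rows that arise in this way are exactly
    the subsets occurring as states of prefixes of w, and a subset with largest
    element u is such a state iff the rest of it is a state of w with its own top
    candidate erased, lying between the states just before the u-th and the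
    (u+1)-st vote for that candidate: unfolding this recursion gives the ABH
    condition. *)

Set Implicit Arguments.
Unset Strict Implicit.
Unset Printing Implicit Defensive.

Implicit Types (v w ds : seq nat) (i j k n p q : nat).

(** * Erasing and inserting the top candidate *)

Definition lower (w : seq nat) : seq nat := [seq x.-1 | x <- w & x != 1].

(* The part of [lower w] preceding the (i+1)-st vote for candidate 1; all of it
   if there are at most i such votes. *)
Fixpoint lower_before (i : nat) (w : seq nat) : seq nat :=
  if w is x :: w' then
    if x == 1 then if i is i'.+1 then lower_before i' w' else [::]
    else x.-1 :: lower_before i w'
  else [::].

(* The entries of [ds] are the gaps between consecutive inserted votes. *)
Fixpoint insert_top (ds : seq nat) (w : seq nat) : seq nat :=
  if ds is d :: ds' then map succn (take d w) ++ 1 :: insert_top ds' (drop d w)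
  else map succn w.

Lemma lower_cons x w :
  lower (x :: w) = if x == 1 then lower w else x.-1 :: lower w.
Proof. by rewrite /lower /=; case: (x == 1). Qed.

Lemma lower_cat v w : lower (v ++ w) = lower v ++ lower w.
Proof. by rewrite /lower filter_cat map_cat. Qed.

Lemma lower_map_succn w : all (leq 1) w -> lower (map succn w) = w.
Proof.
elim: w => //= x w IH /andP[x0 /IH].
by rewrite lower_cons; case: x x0 => // x _ ->.
Qed.

Lemma count_lower k w : 0 < k -> count_mem k (lower w) = count_mem k.+1 w.
Proof.
move=> k0; elim: w => //= x w IH; rewrite lower_cons.
by case: eqP => [->|xn1] /=; rewrite IH; case: k k0 {IH} => //; lia.
Qed.

Lemma size_lower w : count_mem 1 w + size (lower w) = size w.
Proof.
elim: w => //= x w IH; rewrite lower_cons; case: eqP => /= _; lia.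
Qed.

Lemma lower_take q w :
  lower (take q w) = take (size (lower (take q w))) (lower w).
Proof. by rewrite -{3}(cat_take_drop q w) lower_cat take_size_cat. Qed.

Lemma take_lower p w : exists q, take p (lower w) = lower (take q w).
Proof.
elim: w p => [|x w IH] p; first by exists 0.
rewrite lower_cons; case: eqP => [->|/eqP xn1].
  by have [q ->] := IH p; exists q.+1.
case: p => [|p]; first by exists 0.
by have [q /= ->] := IH p; exists q.+1; rewrite take_cons lower_cons (negPf xn1).
Qed.

Lemma lower_beforeE i w :
  exists q, lower_before i w = lower (take q w) /\ count_mem 1 (take q w) <= i.
Proof.
elim: w i => [|x w IH] i; first by exists 0.
move=> /=; case: eqP => [->|/eqP xn1].
  case: i => [|i]; first by exists 0.
  by have [q [-> le]] := IH i; exists q.+1; rewrite /= lower_cons.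
have [q [-> le]] := IH i; exists q.+1.
by rewrite take_cons lower_cons /= (negPf xn1).
Qed.

Lemma lower_before_take i w :
  lower_before i w = take (size (lower_before i w)) (lower w).
Proof. by have [q [-> _]] := lower_beforeE i w; apply: lower_take. Qed.

Lemma size_lower_before i w : size (lower_before i w) <= size (lower w).
Proof. by rewrite lower_before_take size_take_min geq_minr. Qed.

Lemma lower_before_all i w : count_mem 1 w <= i -> lower_before i w = lower w.
Proof.
elim: w i => [|x w IH] i //=; rewrite lower_cons; case: eqP => _ /= le.
  by case: i le => // i; apply: IH.
by rewrite IH.
Qed.

Lemma leq_size_lower_before i j w :
  i <= j -> size (lower_before i w) <= size (lower_before j w).
Proof.
elim: w i j => [|x w IH] i j //= ij; case: eqP => _ /=; last exact: IH.
by case: i j ij => [|i] [|j] //; rewrite ltnS => /IH.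
Qed.

Lemma size_lower_take q w :
  size (lower (take q w)) <= size (lower_before (count_mem 1 (take q w)) w).
Proof.
elim: w q => [|x w IH] [|q] //=; rewrite lower_cons; case: eqP => /= _ //.
by rewrite add0n ltnS.
Qed.

Lemma size_lower_take_gt i q w : i < count_mem 1 (take q w) ->
  size (lower_before i w) <= size (lower (take q w)).
Proof.
elim: w i q => [|x w IH] i [|q] //=; rewrite lower_cons; case: eqP => /= _ lt.
  by case: i lt => // i; apply: IH.
exact: IH.
Qed.

(** Converse to the two preceding bounds: after the (i+1)-st vote for candidate 1 and up to the next
    one, the erased prefix grows one vote at a time, so every length in the interval occurs. *)
Lemma prefix_with_count i q w : i < count_mem 1 w ->
  size (lower_before i w) <= q <= size (lower_before i.+1 w) ->
  exists p, count_mem 1 (take p w) = i.+1 /\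
            lower (take p w) = take q (lower w).
Proof.
elim: w i q => [|x w IH] i q //=; rewrite lower_cons; case: eqP => [->|/eqP xn1] /=.
  case: i => [|i] lt qb.
    have qs : q <= size (lower w).
      by apply: leq_trans (size_lower_before 0 w); case/andP: qb.
    move: {IH lt} qb qs; elim: w q => [|y w IH] q /=; first by exists 1.
    rewrite lower_cons; case: eqP => [->|/eqP yn1] /=.
      by rewrite leqn0 => /eqP -> _; exists 1; rewrite /= ?take0.
    case: q => [|q]; first by exists 1; rewrite /= ?take0.
    rewrite !ltnS => qb /(IH q qb) [[|p] [e1 e2]] //.
    exists p.+2; move: e1 e2; rewrite /= !lower_cons /= (negPf yn1) /= => -> ->.
    by [].
  have [|p [e1 e2]] := IH i q _ qb; first exact: lt.
  by exists p.+1; rewrite /= lower_cons /= e1.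
case: q => [|q]; first by rewrite ltn0.
rewrite !ltnS add0n => lt /(IH i q lt) [p [e1 e2]].
by exists p.+1; rewrite /= lower_cons (negPf xn1) /= e1 e2.
Qed.

(** The sizes of [lower_before] record where the votes for candidate 1 sit: as long as such a vote
    remains, [lower_before 0] is empty exactly when the first entry is 1. *)
Lemma eq_from_lower w1 w2 : all (leq 1) w1 -> all (leq 1) w2 ->
  count_mem 1 w1 = count_mem 1 w2 -> lower w1 = lower w2 ->
  (forall i, i < count_mem 1 w1 ->
     size (lower_before i w1) = size (lower_before i w2)) ->
  w1 = w2.
Proof.
elim: w1 w2 => [|x w1 IH] [|y w2] //=.
- by move=> _ /andP[y0 _]; rewrite lower_cons; case: eqP => //= _; lia.
- by move=> /andP[y0 _] _; rewrite lower_cons; case: eqP => //= _; lia.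
move=> /andP[x0 p1] /andP[y0 p2]; rewrite !lower_cons.
case: (eqVneq x 1) (eqVneq y 1) => [->|xn1] [->|yn1] /=.
- rewrite !add1n => -[c] l h; congr cons; apply: IH => // i lt.
  by have /= := h i.+1 lt.
- by move=> _ _ /(_ 0 isT).
- by move=> c _ h; have /= := h 0; rewrite c => /(_ isT).
- rewrite !add0n => c [xy l] h; congr cons; first by lia.
  by apply: IH => // i /h [].
Qed.

Lemma lower_insert_top ds w : all (leq 1) w -> lower (insert_top ds w) = w.
Proof.
elim: ds w => [|d ds IH] w pw /=; first exact: lower_map_succn.
have := pw; rewrite -{1}(cat_take_drop d w) all_cat => /andP[p1 p2].
by rewrite lower_cat lower_map_succn // lower_cons IH // cat_take_drop.
Qed.

Lemma count_map_succn w : all (leq 1) w -> count_mem 1 (map succn w) = 0.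
Proof.
by elim: w => //= -[|x] w IH //= /IH ->.
Qed.

Lemma count_insert_top ds w :
  all (leq 1) w -> count_mem 1 (insert_top ds w) = size ds.
Proof.
elim: ds w => [|d ds IH] w pw /=; first exact: count_map_succn.
have := pw; rewrite -{1}(cat_take_drop d w) all_cat => /andP[p1 p2].
by rewrite count_cat count_map_succn //= IH.
Qed.

Lemma insert_top_gt0 ds w : all (leq 1) (insert_top ds w).
Proof.
elim: ds w => [|d ds IH] w /=; first by rewrite all_map; apply/allP.
by rewrite all_cat /= IH all_map andbT; apply/allP.
Qed.

Lemma lower_before_map_succn i v w : all (leq 1) v ->
  lower_before i (map succn v ++ w) = v ++ lower_before i w.
Proof. by elim: v => //= -[|x] v IH //= /IH ->. Qed.

Lemma lower_before_insert_top i ds w : all (leq 1) w -> i < size ds ->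
  lower_before i (insert_top ds w) = take (sumn (take i.+1 ds)) w.
Proof.
elim: ds i w => [|d ds IH] i w pw //= lt.
have := pw; rewrite -{1}(cat_take_drop d w) all_cat => /andP[p1 p2].
rewrite lower_before_map_succn //=; case: i lt => [|i] lt.
  by rewrite take0 /= addn0 cats0.
by rewrite IH // -takeD.
Qed.

(** * Ballots and the counts of their prefixes *)

(** With the truncated predecessor, this says that the counts strictly decrease as long as they are
    positive. *)
Definition strictly_leading (w : seq nat) : Prop := forall p k, 0 < k ->
  count_mem k.+1 (take p w) <= (count_mem k (take p w)).-1.

(** Cutting the list of positions at p turns a comparison of the i-th position with p into a
    comparison of i with a prefix count. *)
Lemma vote_positions_split w k p : p <= size w ->
  exists s : seq nat, [/\ vote_positions w k =
      [seq x <- iota 1 p | nth 0 w x.-1 == k] ++ s,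
    size [seq x <- iota 1 p | nth 0 w x.-1 == k] = count_mem k (take p w) &
    {in s, forall x, p < x}].
Proof.
move=> pw; exists [seq x <- iota (1 + p) (size w - p) | nth 0 w x.-1 == k].
split.
- by rewrite -filter_cat -iotaD subnKC.
- rewrite size_filter -(map_nth_iota0 0 pw) (iotaDl 1 0) !count_map.
  exact: eq_count.
- by move=> x; rewrite mem_filter mem_iota => /and3P[].
Qed.

Lemma size_vote_positions w k : size (vote_positions w k) = count_mem k w.
Proof.
rewrite size_filter -{3}(take_size w) -(map_nth_iota0 0 (leqnn _)).
rewrite (iotaDl 1 0) !count_map; exact: eq_count.
Qed.

Lemma vote_position_leq w k i p : 0 < i <= count_mem k w -> p <= size w ->
  (vote_position w k i <= p) = (i <= count_mem k (take p w)).
Proof.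
move=> /andP[i0 ic] pw.
have [s [e sz sP]] := @vote_positions_split w k p pw.
have := size_vote_positions w k; rewrite e size_cat sz => szs.
rewrite /vote_position e nth_cat sz; case: ltnP => h.
  have /(mem_nth 0) : i.-1 < size [seq x <- iota 1 p | nth 0 w x.-1 == k].
    by rewrite sz.
  rewrite mem_filter mem_iota add1n ltnS => /and3P[_ _ ->]. lia.
have /(mem_nth 0) /sP : i.-1 - count_mem k (take p w) < size s by lia.
by rewrite ltnNge => /negPf ->; lia.
Qed.

Lemma vote_positionP w k i : 0 < i <= count_mem k w ->
  0 < vote_position w k i <= size w /\ nth 0 w (vote_position w k i).-1 = k.
Proof.
move=> /andP[i0 ic].
have /(mem_nth 0) : i.-1 < size (vote_positions w k).
  by rewrite size_vote_positions; lia.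
by rewrite mem_filter mem_iota -/(vote_position w k i) => /andP[/eqP -> ?]; lia.
Qed.

Lemma count_take_leq (a : pred nat) p w : count a (take p w) <= count a w.
Proof. by rewrite -{2}(cat_take_drop p w) count_cat leq_addr. Qed.

Lemma strict_ballot_strictly_leading n w : is_strict_ballot n w <->
  [/\ all (fun k => 1 <= k <= n) w,
      forall k, 1 <= k <= n -> count_mem k w = n + 1 - k & strictly_leading w].
Proof.
split=> [/and3P[wn /forallP cw /forallP lw]|[wn cw lw]].
  have {}cw k : 1 <= k <= n -> count_mem k w = n + 1 - k.
    move=> kb; have kn : k < n.+1 by lia.
    by have := cw (Ordinal kn); case/andP: kb => -> _ /eqP.
  split=> // p k k0.
  wlog pw : p / p <= size w.
    move=> th; case: (leqP p (size w)) => [|/ltnW]; first exact: th.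
    by move/take_oversize => ->; have := th _ (leqnn _); rewrite take_size.
  case: (ltnP k n) => kn; last first.
    have c0 : count_mem k.+1 w = 0.
      apply/eqP; rewrite -leqn0 leqNgt -has_count.
      by apply/hasPn => x /(allP wn) /=; lia.
    by have := count_take_leq (pred1 k.+1) p w; rewrite c0 leqn0 => /eqP ->.
  have [->//|c0] := posnP (count_mem k.+1 (take p w)).
  set i := count_mem k.+1 (take p w) in c0 *.
  have ik : 0 < i <= count_mem k.+1 w by rewrite c0 count_take_leq.
  have ik2 : i <= n - k by move: ik; rewrite cw; lia.
  have kn1 : k < n.+1 by lia.
  have in1 : i < n.+1 by lia.
  have /forallP /(_ (Ordinal in1)) /implyP /= := lw (Ordinal kn1).
  have -> : (0 < k <= n - 1) && (0 < i <= n - k) by lia.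
  move=> /(_ isT) lt.
  have : vote_position w k.+1 i <= p by rewrite vote_position_leq.
  move=> /(leq_trans lt) /ltnW; rewrite vote_position_leq //.
    by case: (count_mem k _).
  by rewrite cw; lia.
apply/and3P; split=> //.
  by apply/forallP=> k; apply/implyP=> k0; rewrite cw // k0 -ltnS ltn_ord.
apply/forallP=> k; apply/forallP=> i; apply/implyP=> /andP[kb ib].
have ik : 0 < i <= count_mem k.+1 w by rewrite cw; lia.
have ik1 : 0 < i.+1 <= count_mem (k : nat) w by rewrite cw; lia.
have [/andP[v0 vw] ve] := vote_positionP ik.
have [_ ve'] := vote_positionP ik1.
(* Two candidates cannot share a position, so the weak inequality suffices, and it translates into
   prefix counts. *)
rewrite ltn_neqAle; apply/andP; split.
  by apply/eqP => e; move: ve'; rewrite e ve; lia.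
rewrite vote_position_leq //.
have := lw (vote_position w k.+1 i) k.
have : i <= count_mem k.+1 (take (vote_position w k.+1 i) w).
  by rewrite -vote_position_leq.
lia.
Qed.

(** Recursive form, made for induction by erasing candidate 1. Each level compares only the top two
    candidates, just before each vote for the first and at the end, where the second has most votes
    for a given count of the first. *)
Fixpoint ballot (n : nat) (w : seq nat) : Prop :=
  if n is n'.+1 then
    [/\ all (leq 1) w, count_mem 1 w = n, ballot n' (lower w) &
        forall i, count_mem 1 (lower_before i w) <= i.-1]
  else w = [::].

Lemma ballot_gt0 n w : ballot n w -> all (leq 1) w.
Proof. by case: n => [->|n []]. Qed.

Lemma ballot_lower n w : ballot n.+1 w -> ballot n (lower w).
Proof. by case. Qed.

Lemma ballot_lead n w i :
  ballot n.+1 w -> count_mem 1 (lower_before i w) <= i.-1.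
Proof. by case. Qed.

(** A prefix with c votes for candidate 1 erases to an initial part of [lower_before c w], where the
    bound is known. *)
Lemma count_lower_take n w q : ballot n.+1 w ->
  count_mem 1 (lower (take q w)) <= (count_mem 1 (take q w)).-1.
Proof.
case=> _ _ _ lead; apply: leq_trans (lead _).
rewrite lower_take [X in _ <= count_mem _ X]lower_before_take.
set a := size _; set b := size _.
have /subnKC <- : a <= b by apply: size_lower_take.
by rewrite takeD count_cat leq_addr.
Qed.

Lemma all_lower n w : all (leq 1) w ->
  all (fun k => 1 <= k <= n.+1) w = all (fun k => 1 <= k <= n) (lower w).
Proof.
elim: w => //= x w IH /andP[x0 /IH ->]; rewrite lower_cons.
case: eqP => [->|xn1] //=; congr andb; lia.
Qed.

Lemma strictly_leading_ballot n w :
  [/\ all (fun k => 1 <= k <= n) w,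
      forall k, 1 <= k <= n -> count_mem k w = n + 1 - k & strictly_leading w]
  <-> ballot n w.
Proof.
elim: n w => [|n IH] w /=.
  split=> [[+ _ _]|->]; last by split=> // -[|k].
  by case: w => //= x w /andP[]; lia.
split=> [[wn cw lw]|[w0 c1 /IH [wn cw lw] lead]].
  have w0 : all (leq 1) w by apply: sub_all wn => x /andP[].
  split=> //; first by rewrite cw //; lia.
    apply/IH; split; first by rewrite -all_lower.
      by move=> k kb; rewrite count_lower ?cw //; lia.
    move=> p k k0; have [q ->] := take_lower p w.
    by rewrite !count_lower // lw.
  move=> i; have [q [-> le]] := lower_beforeE i w.
  by rewrite count_lower //; have := lw q 1 isT; lia.
split; first by rewrite all_lower.
  move=> [|[|k]] // kb; first by rewrite c1; lia.
  by rewrite -count_lower // cw; lia.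
move=> q [|[|k]] // _.
  rewrite -count_lower //; apply: (@count_lower_take n); split=> //.
  exact/IH.
by rewrite -(@count_lower k.+1) // -(@count_lower k.+2) // lower_take; apply: lw.
Qed.

Lemma strict_ballotP n w : is_strict_ballot n w <-> ballot n w.
Proof. by rewrite strict_ballot_strictly_leading strictly_leading_ballot. Qed.

(* The conjugate of the partition formed by the vote counts. *)
Fixpoint candidates_ge (n : nat) (v : seq nat) (j : nat) : nat :=
  if n is n'.+1 then (j <= count_mem 1 v) + candidates_ge n' (lower v) j else 0.

Lemma candidates_ge_cat n v v' j :
  candidates_ge n v j <= candidates_ge n (v ++ v') j.
Proof.
elim: n v v' => //= n IH v v'; rewrite lower_cat count_cat leq_add //.
by case: (leqP j (count_mem 1 v)) => //= h; rewrite (leq_trans h) ?leq_addr.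
Qed.

Lemma candidates_ge_take n w p q j : p <= q ->
  candidates_ge n (take p w) j <= candidates_ge n (take q w) j.
Proof. by move/subnKC <-; rewrite takeD candidates_ge_cat. Qed.

Lemma candidates_geS n v j : candidates_ge n v j.+1 <= candidates_ge n v j.
Proof. by elim: n v => //= n IH v; rewrite leq_add //; case: ltnP => //= /ltnW ->. Qed.

(** No candidate ever has more votes than candidate 1. *)
Lemma candidates_ge_eq0 n w q j : ballot n w ->
  count_mem 1 (take q w) < j -> candidates_ge n (take q w) j = 0.
Proof.
elim: n w q => //= n IH w q bw lt; rewrite leqNgt lt /= add0n.
have := count_lower_take q bw; case: bw => _ _ bl _.
rewrite lower_take => le; apply: IH => //.
exact: leq_ltn_trans (leq_trans le (leq_pred _)) lt.
Qed.

(** Positive counts are distinct, so at most one candidate has exactly j votes. *)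
Lemma candidates_ge_leS n w q j : ballot n w -> 0 < j ->
  candidates_ge n (take q w) j <= (candidates_ge n (take q w) j.+1).+1.
Proof.
elim: n w q => //= n IH w q bw j0.
have := count_lower_take q bw; case: (bw) => _ _ bl _.
rewrite lower_take => le.
case: (ltngtP j (count_mem 1 (take q w))) => h /=; rewrite ?add1n ?ltnS ?add0n.
- exact: IH.
- exact: IH.
- by rewrite candidates_ge_eq0 //; lia.
Qed.

Lemma sum_leq_indicator c L : c <= L -> \sum_(1 <= j < L.+1) (j <= c) = c.
Proof.
move=> cL; rewrite (big_cat_nat _ (n := c.+1)) //=.
rewrite (eq_big_nat _ _ (F2 := fun=> 1)) => [|j]; last by rewrite ltnS => /andP[_ ->].
rewrite sum_nat_const_nat muln1 subn1 /= big_nat big1 ?addn0 // => j /andP[h _].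
by rewrite leqNgt h.
Qed.

(** Double counting: a partition and its conjugate have the same size. *)
Lemma sum_candidates_ge n w q L : ballot n w -> count_mem 1 (take q w) <= L ->
  \sum_(1 <= j < L.+1) candidates_ge n (take q w) j = size (take q w).
Proof.
elim: n w q => [|n IH] w q bw cL; first by rewrite [w]bw big1.
rewrite big_split /= sum_leq_indicator // -[in RHS]size_lower.
have := count_lower_take q bw; case: bw => _ _ bl _.
rewrite lower_take => le; rewrite IH //; lia.
Qed.

(** The length of a prefix is the sum of its conjugate counts, so comparing these counts compares
    the prefixes. *)
Lemma leq_from_candidates_ge n w p q L : ballot n w ->
  p <= size w -> q <= size w -> count_mem 1 (take p w) <= L ->
  (forall j, 1 <= j <= L ->
     candidates_ge n (take p w) j <= candidates_ge n (take q w) j) -> p <= q.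
Proof.
move=> bw pw qw cL h; rewrite -(size_takel pw) -(size_takel qw).
rewrite -(sum_candidates_ge bw cL).
(* [L] bounds the counts of the first prefix only; the second may reach higher levels, which just
   enlarge the right-hand side. *)
rewrite -(@sum_candidates_ge n w q (maxn L (count_mem 1 (take q w)))) ?leq_maxr //.
rewrite [leqRHS](big_cat_nat _ (n := L.+1)) //=; last by rewrite ltnS leq_maxl.
by apply: leq_trans (leq_addr _ _); rewrite !big_nat leq_sum // => j; apply: h.
Qed.

Lemma candidates_ge_gt0 n w q j : ballot n.+1 w ->
  (0 < candidates_ge n.+1 (take q w) j) = (j <= count_mem 1 (take q w)).
Proof.
move=> bw; case: (leqP j _) => h; first by rewrite /= h.
by rewrite candidates_ge_eq0.
Qed.

(** * Hypertriangles in terms of tail sums *)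

(** All conditions on hypertriangles compare sums over final segments of rows. For the indicator of
    a set of vote counts, this sum is the number of candidates with at least j votes. *)
Definition tail_sum (b : nat -> bool) (t j : nat) : nat :=
  \sum_(j <= k < t.+1) b k.

Lemma tail_sum_recl b t j : j <= t -> tail_sum b t j = b j + tail_sum b t j.+1.
Proof. by move=> jt; rewrite /tail_sum big_ltn. Qed.

Lemma tail_sum_gt b t j : t < j -> tail_sum b t j = 0.
Proof. by move=> tj; rewrite /tail_sum big_geq. Qed.

Lemma tail_sum_recr b t j : j <= t.+1 ->
  tail_sum b t.+1 j = tail_sum b t j + b t.+1.
Proof. by move=> jt; rewrite /tail_sum big_nat_recr. Qed.

Lemma tail_sum_leq b t j : tail_sum b t j <= t.+1 - j.
Proof.
rewrite -[leqRHS]muln1 -sum_nat_const_nat; apply: leq_sum => k _.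
exact: leq_b1.
Qed.

Lemma prec_subrowP (T T' : triangle) i i' p q :
  reflect (p <= q /\ forall l, 1 <= l <= p ->
             tail_sum (entry T i) p l <= tail_sum (entry T' i') q l)
          (prec (subrow T i 1 p) (subrow T' i' 1 q)).
Proof.
have sz U i0 r : size (subrow U i0 1 r) = r.
  by rewrite size_map size_iota subn1.
have tailE U i0 r l : 0 < l ->
    \sum_(l <= k < r.+1) nth false (subrow U i0 1 r) k.-1
      = tail_sum (entry U i0) r l.
  move=> l0; apply: eq_big_nat => k kb; rewrite (nth_map 0).
    by rewrite nth_iota ?subn1 1?addnC ?addn1 ?prednK //; lia.
  by rewrite size_iota; lia.
apply: (iffP andP); rewrite !sz => -[pq h]; split=> //.
  move=> l lb; have lp : l < p.+1 by lia.
  have /= := forallP h (Ordinal lp).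
  by rewrite !tailE; last lia; last lia; case/andP: lb => ->.
apply/forallP => l; apply/implyP => l0; rewrite !tailE //.
by apply: h; rewrite l0 -ltnS ltn_ord.
Qed.

(** The two comparisons of the ABH condition, with t' = u-1. For u = 2 the lower one is vacuous, in
    agreement with the guard 1 < t'. *)
Definition between (H : seq triangle) (s' : nat) (b : nat -> bool) (u : nat) :=
  (forall l, 1 <= l <= u.-2 ->
     tail_sum (entry (component H s') u.-2) u.-2 l <= tail_sum b u.-1 l) /\
  (forall l, 1 <= l <= u.-1 ->
     tail_sum b u.-1 l <= tail_sum (entry (component H s') u.-1) u.-1 l).

Lemma ABH_conditionP (H : seq triangle) s t u : 2 <= u <= t -> t <= s ->
  ABH_condition H s t u <->
  between H (s - tail_sum (entry (component H s) t) t u)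
          (entry (component H s) t) u.
Proof.
move=> ut ts; rewrite /ABH_condition /between -/(tail_sum _ t u).
have := tail_sum_leq (entry (component H s) t) t u.
set r := tail_sum _ t u => rle.
(* There are at most t+1-u ones from u to t, and t <= s, so s' is at least u-1. *)
rewrite !subn1 (_ : u.-1 <= s - r) ?andbT; last by lia.
rewrite (_ : 0 < u.-1) /=; last by lia.
split=> [/andP[/implyP h1 /prec_subrowP[_ h2]]|[h1 h2]].
  split=> // l lb; have : 1 < u.-1 by lia.
  by move/h1/prec_subrowP => [_ /(_ l lb)].
apply/andP; split; last by apply/prec_subrowP.
by apply/implyP => _; apply/prec_subrowP; split=> //; apply: leq_pred.
Qed.

(* The ABH condition on a row [b] of length [t] of the triangle of size
   [(size H).+1] put in front of [H]. *)
Definition compatible (H : seq triangle) (b : nat -> bool) (t : nat) : Prop :=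
  forall u, 2 <= u <= t -> b u ->
    between H ((size H).+1 - tail_sum b t u) b u.

Lemma component_head (A : triangle) H : component (A :: H) (size H).+1 = A.
Proof. by rewrite /component /= subnn. Qed.

Lemma component_behead (A : triangle) H s :
  s <= size H -> component (A :: H) s = component H s.
Proof. by move=> sH; rewrite /component /= subSn. Qed.

Lemma is_ABTP m (A : triangle) :
  is_ABT m A <-> triangle_shape m A /\
    forall i j, 1 <= j <= i -> i < m ->
      tail_sum (entry A i) i j <= tail_sum (entry A i.+1) i.+1 j.
Proof.
split=> [/andP[sh h]|[sh h]].
  split=> // i j ji im; have im1 : i < m.+1 by lia.
  have jm1 : j < m.+1 by lia.
  have /forallP/(_ (Ordinal jm1))/implyP := forallP h (Ordinal im1).
  by apply => /=; lia.
apply/andP; split=> //; apply/forallP => i; apply/forallP => j; apply/implyP.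
by move=> /andP[ji im]; apply: h => //; lia.
Qed.

Lemma is_ABHP m (H : seq triangle) :
  is_ABH m H <-> [/\ size H = m,
    forall s, 1 <= s <= m -> is_ABT s (component H s) &
    forall s t u, 2 <= u <= t -> t <= s -> s <= m -> entry (component H s) t u ->
      between H (s - tail_sum (entry (component H s) t) t u)
        (entry (component H s) t) u].
Proof.
split=> [/and3P[/eqP sz abt cond]|[sz abt cond]].
  split=> // [s sb|s t u ut ts sm e].
    have sm : s < m.+1 by lia.
    by have /implyP := forallP abt (Ordinal sm); apply => /=; lia.
  apply/ABH_conditionP => //.
  have sm1 : s < m.+1 by lia.
  have tm1 : t < m.+1 by lia.
  have um1 : u < m.+1 by lia.
  have /forallP/(_ (Ordinal tm1))/forallP/(_ (Ordinal um1))/implyP :=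
    forallP cond (Ordinal sm1).
  by apply => /=; case/andP: ut => -> ->; rewrite ts e.
apply/and3P; split; first exact/eqP.
  apply/forallP => s; apply/implyP => s0; apply: abt.
  by rewrite s0 -ltnS ltn_ord.
apply/forallP => s; apply/forallP => t; apply/forallP => u; apply/implyP.
move=> /and4P[u2 ut ts e]; apply/ABH_conditionP => //; first by rewrite u2.
by apply: cond => //; rewrite ?u2 // -ltnS ltn_ord.
Qed.

(** An entry 1 at u makes s' smaller than s, so conditions on a triangle refer only to those after
    it in the list, and the head can be peeled off. *)
Lemma is_ABH_cons m (A : triangle) H :
  is_ABH m.+1 (A :: H) <-> [/\ is_ABH m H, is_ABT m.+1 A &
    forall t, 1 <= t <= m.+1 -> compatible H (entry A t) t].
Proof.
have s'lt s (b : nat -> bool) t u : u <= t -> b u ->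
    0 < s -> s - tail_sum b t u < s.
  by move=> ut bu s0; rewrite tail_sum_recl // bu; lia.
split.
  move=> /is_ABHP [[sz] abt cond].
  have chd : component (A :: H) m.+1 = A by rewrite -sz component_head.
  have cbh s : s <= m -> component (A :: H) s = component H s.
    by rewrite -sz; apply: component_behead.
  split.
  - apply/is_ABHP; split=> // [s sb|s t u ut ts sm e].
      by rewrite -cbh ?abt //; lia.
    have := cond s t u ut ts; rewrite cbh // /between => /(_ (leqW sm) e).
    by rewrite cbh //; apply: leq_trans (leq_subr _ _) sm.
  - by rewrite -[A in is_ABT _ A]chd abt //; lia.
  - move=> t tb u ut e.
    have tm : t <= m.+1 by lia.
    have := cond m.+1 t u ut tm (leqnn _); rewrite chd => /(_ e).
    rewrite /between sz cbh //; rewrite -ltnS; apply: s'lt => //.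
    by case/andP: ut.
move=> [/is_ABHP [sz abt cond] abtA comp].
have chd : component (A :: H) m.+1 = A by rewrite -sz component_head.
have cbh s : s <= m -> component (A :: H) s = component H s.
  by rewrite -sz; apply: component_behead.
apply/is_ABHP; split=> /= [|s sb|s t u ut ts sm]; first by rewrite sz.
  case: (ltngtP s m.+1) => [sm|?|->]; [|lia|by rewrite chd].
  by rewrite cbh ?abt //; lia.
case: (ltngtP s m.+1) ts sm => // [sm|->] ts _.
  rewrite cbh // => e; have := cond s t u ut ts sm e.
  by rewrite /between cbh //; apply: leq_trans (leq_subr _ _) _; rewrite -ltnS.
rewrite chd => e; have := comp t; rewrite ts andbT => /(_ _ u ut e).
rewrite /between sz cbh; first by apply; lia.
rewrite -ltnS; apply: s'lt => //; by case/andP: ut.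
Qed.

(** * The hypertriangle of a ballot *)

(** [candidates_ge] drops at u when some candidate has exactly u votes. The rows start at
    [lower_before 2 w], since [lower_before 0 w] and [lower_before 1 w] are empty for a ballot. *)
Definition ballot_triangle (m : nat) (w : seq nat) : triangle :=
  [seq [seq candidates_ge m.+1 (lower_before i.+1 w) u.+1
              < candidates_ge m.+1 (lower_before i.+1 w) u | u <- iota 1 i]
      | i <- iota 1 m].

Fixpoint ballot_hypertriangle (m : nat) (w : seq nat) : seq triangle :=
  if m is m'.+1 then ballot_triangle m w :: ballot_hypertriangle m' (lower w)
  else [::].

Lemma size_ballot_hypertriangle m w : size (ballot_hypertriangle m w) = m.
Proof. by elim: m w => //= m IH w; rewrite IH. Qed.

Lemma entry_ballot_triangle m w i u : 1 <= u <= i -> i <= m ->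
  entry (ballot_triangle m w) i u =
  (candidates_ge m.+1 (lower_before i.+1 w) u.+1
     < candidates_ge m.+1 (lower_before i.+1 w) u).
Proof.
case: u i => [|u] [|i] // ui im; rewrite /entry (nth_map 0) ?size_iota //.
by rewrite nth_iota // add1n (nth_map 0) ?size_iota // nth_iota ?add1n.
Qed.

(** Each drop of [candidates_ge] is 0 or 1, so the indicators of the drops telescope, down from the
    value 0 above t. *)
Lemma tail_sum_candidates_ge n w q t (b : nat -> bool) :
  ballot n w -> count_mem 1 (take q w) <= t ->
  (forall u, 1 <= u <= t -> b u =
     (candidates_ge n (take q w) u.+1 < candidates_ge n (take q w) u)) ->
  forall j, 0 < j -> tail_sum b t j = candidates_ge n (take q w) j.
Proof.
move=> bw ct bE j j0; case: (ltnP t j) => [tj|jt].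
  by rewrite tail_sum_gt ?candidates_ge_eq0 //; apply: leq_ltn_trans tj.
have [d] := ubnP (t - j); elim: d j j0 jt => // d IH j j0 jt lt.
rewrite tail_sum_recl // bE ?j0 //.
have -> : tail_sum b t j.+1 = candidates_ge n (take q w) j.+1.
  case: (ltnP t j.+1) => [tj|jt']; last by apply: IH => //; lia.
  by rewrite tail_sum_gt ?candidates_ge_eq0 //; apply: leq_ltn_trans tj.
have := candidates_ge_leS q bw j0; have := candidates_geS n (take q w) j.
by case: ltnP; lia.
Qed.

Lemma tail_sum_ballot_triangle m w i j : ballot m.+2 w -> i <= m -> 0 < j ->
  tail_sum (entry (ballot_triangle m w) i) i j =
  candidates_ge m.+1 (lower_before i.+1 w) j.
Proof.
case=> _ _ bl lead im; rewrite lower_before_take => j0.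
apply: tail_sum_candidates_ge => //; rewrite -lower_before_take ?lead // => u ub.
exact: entry_ballot_triangle.
Qed.

(** Before the second vote for candidate 1 the next candidate has none, hence neither have the
    others: [L = 0] bounds all counts. *)
Lemma lower_before_nil n w i : ballot n.+1 w -> i <= 1 -> lower_before i w = [::].
Proof.
case=> _ _ bl lead i1; apply/eqP; rewrite -size_eq0 -leqn0.
apply: (leq_from_candidates_ge (L := 0) bl) => //.
- exact: size_lower_before.
- by rewrite -lower_before_take; apply: leq_trans (lead i) _; lia.
- by move=> j; lia.
Qed.

(** * Rows realised as states of prefixes of a ballot *)

(** Splits off the largest element u of the subset encoded by b, if there is one; the recursions
    below run on this u. *)
Lemma tail_sum_top (b : nat -> bool) t :
  (forall j, 0 < j -> tail_sum b t j = 0) \/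
  exists u, [/\ 1 <= u <= t, b u &
    forall j, 0 < j -> tail_sum b t j = (j <= u) + tail_sum b u.-1 j].
Proof.
elim: t => [|t IH]; first by left => j j0; rewrite tail_sum_gt.
case bt : (b t.+1).
  right; exists t.+1; rewrite ltnS leqnn; split=> // j j0; case: leqP => jt.
    by rewrite tail_sum_recr // bt addnC.
  by rewrite !tail_sum_gt //; lia.
have e j : tail_sum b t.+1 j = tail_sum b t j.
  case: (leqP j t.+1) => jt; first by rewrite tail_sum_recr // bt addn0.
  by rewrite !tail_sum_gt //; lia.
case: IH => [h|[u [ut bu h]]]; [left|right] => [j j0|]; first by rewrite e h.
by exists u; split=> // [|j j0]; [lia|rewrite e h].
Qed.

(** The subset of {1, ..., t} encoded by b is the set of positive vote counts after q votes; the
    equality is stated through conjugate counts. *)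
Definition is_state (n : nat) (w : seq nat) (b : nat -> bool) (t : nat) : Prop :=
  exists q, [/\ q <= size w, count_mem 1 (take q w) <= t &
    forall j, 0 < j -> tail_sum b t j = candidates_ge n (take q w) j].

Lemma is_state0 n w (b : nat -> bool) t : ballot n w ->
  (forall j, 0 < j -> tail_sum b t j = 0) -> is_state n w b t.
Proof.
move=> bw h; exists 0; split=> //; first by rewrite take0.
by move=> j j0; rewrite h // candidates_ge_eq0 // take0.
Qed.

(** The largest element u is the count of candidate 1. The other counts come from the erased prefix,
    whose possible lengths fill the interval of [prefix_with_count]. *)
Lemma is_state_lower n w (b : nat -> bool) t u : ballot n.+1 w ->
  1 <= u <= t -> u <= n.+1 ->
  (forall j, 0 < j -> tail_sum b t j = (j <= u) + tail_sum b u.-1 j) ->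
  is_state n.+1 w b t <->
  exists q, [/\ q <= size (lower w), count_mem 1 (take q (lower w)) <= u.-1,
    forall j, 0 < j -> tail_sum b u.-1 j = candidates_ge n (take q (lower w)) j &
    size (lower_before u.-1 w) <= q <= size (lower_before u w)].
Proof.
move=> bw ut un bE; have u0 : 0 < u by case/andP: ut.
split=> [[q [qw ct tE]]|[q [qw ct tE qb]]].
  (* The count of candidate 1 is the last level at which [candidates_ge] is positive, and u is the
     last level at which the tail sum is. *)
  have cE : count_mem 1 (take q w) = u.
    apply/eqP; rewrite eqn_leq -(candidates_ge_gt0 _ _ bw) -tE // bE // leqnn andbT.
    rewrite leqNgt; apply/negP => uc.
    have c0 := leq_ltn_trans (leq0n u) uc.
    have : 0 < candidates_ge n.+1 (take q w) (count_mem 1 (take q w)).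
      by rewrite candidates_ge_gt0.
    rewrite -tE // bE // [_ <= u]leqNgt uc /= tail_sum_gt //.
    exact: leq_ltn_trans (leq_pred u) uc.
  exists (size (lower (take q w))); rewrite -lower_take; split.
  - by rewrite lower_take size_take_min geq_minr.
  - by rewrite -cE; apply: count_lower_take bw.
  - by move=> j j0; have := tE j j0; rewrite bE //= cE => /addnI.
  - rewrite -{2}cE size_lower_take andbT size_lower_take_gt // cE.
    by rewrite prednK.
case: (bw) => _ c1 _ _.
have [||p [e1 e2]] := @prefix_with_count u.-1 q w; rewrite ?prednK //.
  by rewrite c1.
exists (minn p (size w)).
rewrite geq_minr take_min take_size e1 prednK //; split=> //; first by case/andP: ut.
by move=> j j0; rewrite bE // tE //= e1 prednK // e2.
Qed.

(** At k = u the tail sum is 1, so s' designates [A]. At a smaller element, dropping both [A] and u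
    leaves s' unchanged, since the tail sum contains u; s' then lies within [H]. *)
Lemma compatible_cons (A : triangle) H (b : nat -> bool) t u : 1 <= u <= t ->
  t <= (size H).+2 -> b u ->
  (forall j, 0 < j -> tail_sum b t j = (j <= u) + tail_sum b u.-1 j) ->
  compatible (A :: H) b t <->
  compatible H b u.-1 /\ (2 <= u -> between (A :: H) (size H).+1 b u).
Proof.
move=> ut tH bu bE.
have top k : k <= t -> b k -> 0 < k -> k <= u.
  move=> kt bk k0; rewrite leqNgt; apply/negP => uk.
  have := bE k k0; rewrite tail_sum_recl // bk leqNgt uk (@tail_sum_gt _ u.-1) //; lia.
have s'E k : 0 < k -> k <= u.-1 -> b k ->
    (size H).+2 - tail_sum b t k = (size H).+1 - tail_sum b u.-1 k.
  by move=> k0 ku bk; rewrite bE // (_ : k <= u); lia.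
have s'le k : k <= u.-1 -> b k -> (size H).+1 - tail_sum b u.-1 k <= size H.
  by move=> ku bk; rewrite tail_sum_recl // bk; lia.
have s'u : (size H).+2 - tail_sum b t u = (size H).+1.
  by rewrite bE ?leqnn ?tail_sum_gt; lia.
split=> [comp|[comp top_between] k kt bk].
  split=> [k ku bk|u2]; last by have := comp u; rewrite /= s'u; apply=> //; lia.
  have := comp k _ bk; rewrite /= s'E //; try lia.
  by rewrite /between component_behead ?s'le //; [apply; lia|lia].
rewrite /=; have : k <= u by apply: top => //; lia.
rewrite leq_eqVlt => /orP[/eqP ku|ku].
  by rewrite ku s'u; apply: top_between; lia.
rewrite s'E //; try lia.
rewrite /between component_behead ?s'le //; last by lia.
by apply: comp => //; lia.
Qed.

(** Both sides satisfy the same recursion on the largest element u: rows u-2 and u-1 of the head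
    triangle are the states of [lower_before u.-1 w] and [lower_before u w], so [between] says that
    q lies between their lengths. *)
Lemma compatible_ballot_hypertriangle m w (b : nat -> bool) t :
  ballot m.+2 w -> t <= m.+1 ->
  compatible (ballot_hypertriangle m w) b t <-> is_state m.+2 w b t.
Proof.
elim: m w b t => [|m IH] w b t bw tm;
    have [b0|[u [ut bu bE]]] := tail_sum_top b t.
- by split=> [_|_ u]; [exact: is_state0|lia].
- split=> [_|_ k]; last by lia.
  have u1 : u = 1 by lia.
  apply/(is_state_lower bw ut _ bE); first by lia.
  exists 0; rewrite u1 take0; split=> //.
    move=> j j0; rewrite tail_sum_gt //.
    by case: (bw) => _ _ bl _; rewrite -(take0 (lower w)) candidates_ge_eq0 ?take0.
  by rewrite (lower_before_nil bw).
- split=> [_|_ u ut bu]; first exact: is_state0.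
  have u0 : 0 < u by lia.
  by have := b0 u u0; rewrite tail_sum_recl ?bu //; lia.
have bl := ballot_lower bw; have lead i := ballot_lead i bw.
have um : u.-1 <= m.+1 by lia.
have sz : size (ballot_hypertriangle m (lower w)) = m.
  exact: size_ballot_hypertriangle.
have un : u <= m.+3 by lia.
have tsz : t <= (size (ballot_hypertriangle m (lower w))).+2 by rewrite sz.
rewrite (is_state_lower bw ut un bE) /= (compatible_cons _ ut tsz bu bE).
rewrite (IH _ _ _ bl um) /between component_head.
have rowE i j : i <= m.+1 -> 0 < j ->
    tail_sum (entry (ballot_triangle m.+1 w) i) i j =
    candidates_ge m.+2 (take (size (lower_before i.+1 w)) (lower w)) j.
  by rewrite -lower_before_take; apply: tail_sum_ballot_triangle.
have sz_le := size_lower_before.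
have lead' i : count_mem 1 (take (size (lower_before i w)) (lower w)) <= i.-1.
  by rewrite -lower_before_take.
split=> [[[q [qw ct tE]] bnd]|[q [qw ct tE /andP[q1 q2]]]].
  (* For u = 1 both bounds are 0, and q = 0 because candidate 1 of [lower w] has no vote yet. *)
  exists q; split=> //; case: (leqP u 1) => u1.
    have -> : u = 1 by lia.
    rewrite !(lower_before_nil bw) //=.
    apply: (@leq_from_candidates_ge _ _ q 0 0 bl) => // [|j jb]; last by lia.
    by apply: leq_trans ct _; lia.
  have [lo hi] := bnd u1; apply/andP; split.
    apply: (leq_from_candidates_ge (L := u.-2) bl) => // j jb.
    have := lo j jb; rewrite rowE ?tE ?prednK //; lia.
  apply: (leq_from_candidates_ge (L := u.-1) bl) => // j jb.
  have := hi j jb; rewrite rowE ?tE ?prednK //; lia.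
split; first by exists q.
move=> u2; split=> j jb.
  rewrite rowE ?tE ?prednK; try lia.
  exact: candidates_ge_take.
rewrite rowE ?tE ?prednK; try lia.
exact: candidates_ge_take.
Qed.

(** * Bijectivity of the construction *)

Lemma ballot_triangle_shape m w : triangle_shape m (ballot_triangle m w).
Proof.
rewrite /triangle_shape /shape -map_comp -[X in _ == X]map_id; apply/eqP.
by apply: eq_map => i /=; rewrite size_map size_iota.
Qed.

Lemma eq_triangle m (A B : triangle) :
  triangle_shape m A -> triangle_shape m B ->
  (forall i u, 1 <= u <= i -> i <= m -> entry A i u = entry B i u) -> A = B.
Proof.
have rows (T : triangle) : triangle_shape m T ->
    size T = m /\ forall i, i < m -> size (nth [::] T i) = i.+1.
  move=> /eqP sh; have sz : size T = m by rewrite -(size_map size) -/(shape T) sh size_iota.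
  split=> // i im; rewrite -(nth_map _ 0) ?sz // -/(shape T) sh nth_iota //.
move=> /rows[szA rA] /rows[szB rB] e; apply: (@eq_from_nth _ [::]); first by rewrite szB.
move=> i; rewrite szA => im; apply: (@eq_from_nth _ false); first by rewrite rA ?rB.
by move=> u; rewrite rA // => ui; apply: (e i.+1 u.+1).
Qed.

(** Growth of the prefixes [lower_before] gives the ABT inequality; the rows are states of
    [lower w], hence compatible. *)
Lemma ballot_hypertriangle_ABH m w :
  ballot m.+2 w -> is_ABH m (ballot_hypertriangle m w).
Proof.
elim: m w => [|m IH] w bw.
  by apply/is_ABHP; split=> // [s|s t u]; lia.
have bl := ballot_lower bw; apply/is_ABH_cons; split; first exact: IH.
  apply/is_ABTP; split=> [|i j ji im]; first exact: ballot_triangle_shape.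
  rewrite !tail_sum_ballot_triangle //; try lia.
  rewrite lower_before_take [X in _ <= candidates_ge _ X _]lower_before_take.
  exact/candidates_ge_take/leq_size_lower_before.
move=> t tb; apply/compatible_ballot_hypertriangle => //; first by lia.
exists (size (lower_before t.+1 w)); rewrite -lower_before_take; split.
- exact: size_lower_before.
- exact: (ballot_lead t.+1 bw).
- by move=> j j0; apply: tail_sum_ballot_triangle => //; lia.
Qed.

(** The tail of the list determines [lower w] by induction, and the head determines the lengths of
    the [lower_before], compared in both directions. *)
Lemma ballot_hypertriangle_inj m w1 w2 : ballot m.+2 w1 -> ballot m.+2 w2 ->
  ballot_hypertriangle m w1 = ballot_hypertriangle m w2 -> w1 = w2.
Proof.
have le_before n v1 v2 i : ballot n.+2 v1 -> ballot n.+2 v2 -> lower v1 = lower v2 ->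
    ballot_triangle n v1 = ballot_triangle n v2 -> i <= n.+1 ->
    size (lower_before i v1) <= size (lower_before i v2).
  move=> b1 b2 el et i_n; have bl := ballot_lower b1.
  apply: (leq_from_candidates_ge (L := i.-1) bl).
  - exact: size_lower_before.
  - by rewrite el size_lower_before.
  - by rewrite -lower_before_take (ballot_lead i b1).
  move=> j jb; rewrite -lower_before_take el -lower_before_take.
  have iE : i = i.-1.+1 by lia.
  by rewrite iE -!tail_sum_ballot_triangle ?et //; lia.
have eq_ballot n v1 v2 : ballot n.+2 v1 -> ballot n.+2 v2 -> lower v1 = lower v2 ->
    ballot_triangle n v1 = ballot_triangle n v2 -> v1 = v2.
  move=> b1 b2 el et; have [p1 c1 _ _] := b1; have [p2 c2 _ _] := b2.
  apply: eq_from_lower => // [|i]; rewrite c1 ?c2 // ltnS => i_n.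
  by apply/eqP; rewrite eqn_leq !(le_before n).
elim: m w1 w2 => [|m IH] w1 w2 b1 b2; last first.
  move=> e; apply: (eq_ballot m.+1) => //; last exact: (congr1 (head [::]) e).
  by apply: IH (congr1 behead e); apply: ballot_lower.
(* There are no triangles here; the erased ballots have one candidate and one vote, so they
   agree. *)
move=> _; apply: (eq_ballot 0) => //.
have [q1 d1 l1 _] := ballot_lower b1; have [q2 d2 l2 _] := ballot_lower b2.
apply: eq_from_lower => // [||i]; rewrite ?d1 ?d2 ?l1 ?l2 // => i1.
by rewrite (lower_before_nil (ballot_lower b1)) ?(lower_before_nil (ballot_lower b2)) // ltnW.
Qed.

Lemma insert_at_positions w (pos : nat -> nat) c : all (leq 1) w ->
  (forall i, i.+1 < c -> pos i <= pos i.+1) ->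
  exists w', [/\ all (leq 1) w', lower w' = w, count_mem 1 w' = c &
    forall i, i < c -> lower_before i w' = take (pos i) w].
Proof.
move=> w0 mono.
pose d i := if i is k.+1 then pos k.+1 - pos k else pos 0.
have sumE i : i < c -> sumn (take i.+1 (mkseq d c)) = pos i.
  move=> ic; rewrite /mkseq -map_take take_iota (minn_idPl ic).
  elim: i ic => [|i IH] ic; first by rewrite /= addn0.
  rewrite -(addn1 i.+1) iotaD map_cat sumn_cat (IH (ltnW ic)) /= addn0.
  by rewrite subnKC // mono.
exists (insert_top (mkseq d c) w); split.
- exact: insert_top_gt0.
- exact: lower_insert_top.
- by rewrite count_insert_top // size_mkseq.
- by move=> i ic; rewrite lower_before_insert_top ?size_mkseq // sumE.
Qed.

(** Induction provides w for the tail of the list. Compatibility makes each row of the head a state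
    of w, and a new top candidate is inserted at the corresponding places. *)
Lemma ballot_hypertriangle_surj m (H : seq triangle) : is_ABH m H ->
  exists2 w, ballot m.+2 w & ballot_hypertriangle m w = H.
Proof.
elim: m H => [|m IH] H.
  move=> /is_ABHP[/size0nil -> _ _]; exists [:: 1; 1; 2] => //.
  by split=> // [|[|[|[|i]]]] //; split=> // -[|[|i]].
case: H => [/is_ABHP[]//|A H] /is_ABH_cons[/IH [w bw <-] /is_ABTP[shA mA] comp].
have w0 := ballot_gt0 bw.
pose tl t := tail_sum (entry A t) t.
(* By double counting, this is the length of the prefix of w whose state is row t. *)
pose pos t := \sum_(1 <= j < t.+1) tl t j.
have pos0 : pos 0 = 0 by rewrite /pos big_geq.
have posP t : 1 <= t <= m.+1 -> count_mem 1 (take (pos t) w) <= t /\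
    forall j, 0 < j -> tl t j = candidates_ge m.+2 (take (pos t) w) j.
  move=> tb; have tm : t <= m.+1 by lia.
  have /(compatible_ballot_hypertriangle _ bw tm) [q [qw ct tE]] := comp t tb.
  suff -> : pos t = q by [].
  rewrite -(size_takel qw) -(sum_candidates_ge bw ct).
  by apply: eq_big_nat => j /andP[j0 _]; apply: tE.
have mono i : i.+1 < m.+3 -> pos i.-1 <= pos i.
  case: i => [|[|i]] //= im; first by rewrite pos0.
  rewrite /pos [leqRHS]big_nat_recr //=; apply: leq_trans (leq_addr _ _).
  by rewrite !big_nat; apply: leq_sum => j jb; apply: mA => //; lia.
(* The shift by [predn] puts the first two new votes at place 0 and the (t+2)-nd at [pos t]. *)
have [w' [w'0 lE cE lbE]] := @insert_at_positions w (pos \o predn) m.+3 w0 mono.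
have bw' : ballot m.+3 w'.
  split=> //; first by rewrite lE.
  move=> i; case: (ltnP i m.+3) => im.
    rewrite lbE //=; case: i im => [|[|i]] im; rewrite /= ?pos0 ?take0 //.
    by have [|-> _] := posP i.+1; first by lia.
  rewrite lower_before_all ?cE // lE; have [_ -> _ _] := bw; lia.
exists w' => //=; rewrite lE; congr cons.
apply: (eq_triangle (ballot_triangle_shape _ _) shA) => i u ub im.
have [|_ tE] := posP i; first by lia.
have u0 : 0 < u by case/andP: ub.
have lbi : lower_before i.+1 w' = take (pos i) w by rewrite lbE.
rewrite entry_ballot_triangle // lbi -!tE //.
rewrite /tl [X in _ < X]tail_sum_recl; last by lia.
by case: (entry A i u); rewrite ?ltnS ?leqnn ?ltnn.
Qed.

Theorem theorem1p2 (n : nat) (hn : 3 <= n) :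
  exists f : ABH (n - 2) -> strict_ballot n, bijective f.
Proof.
have [m nE mE] : exists2 m, n = m.+2 & n - 2 = m by exists (n - 2); lia.
rewrite {}mE {}nE {hn}.
(* The construction goes from ballots to hypertriangles; its inverse is obtained by choosing
   preimages, which are unique by injectivity. *)
pose Ballot : choiceType := {w | is_strict_ballot m.+2 w}.
have wd (w : Ballot) : is_ABH m (ballot_hypertriangle m (val w)).
  exact/ballot_hypertriangle_ABH/strict_ballotP/(valP w).
pose g (w : Ballot) : {H | is_ABH m H} := exist (fun H => is_ABH m H) _ (wd w).
have g_inj : injective g.
  move=> w1 w2 /(congr1 val) /= e; apply: val_inj.
  by apply: ballot_hypertriangle_inj e; apply/strict_ballotP; apply: valP.
have g_surj (H : {H | is_ABH m H}) : exists b, g b == H.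
  have [w bw e] := ballot_hypertriangle_surj (valP H).
  have sw : is_strict_ballot m.+2 w by apply/strict_ballotP.
  by exists (exist (fun w => is_strict_ballot m.+2 w) w sw); apply/eqP/val_inj.
exists (fun H => xchoose (g_surj H)); exists g => [H|w].
  exact/eqP/(xchooseP (g_surj H)).
exact/g_inj/eqP/(xchooseP (g_surj (g w))).
Qed.
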